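(* Let $\mathcal{E}$ be the Dirichlet form of a generator $L$ on a finite probability space $(\Omega,\mu)$. Let $p,q\in(0,2]\setminus\{1\}$ with $p>q$. Then for every $g\in\mathcal{H}_{(0,\infty)}$, $$qq'\,\mathcal{E}(g^{1/q},g^{1/q'})\ge pp'\,\mathcal{E}(g^{1/p},g^{1/p'}).$$
   Context: Setting: $(\Omega,\mu)$ is a finite probability space with $\mu\{\omega\}>0$ for all $\omega\in\Omega$; $\mathbb{E}f=\int_\Omega f\,d\mu$; $\mathcal{H}$ is the space of real-valued functions on $\Omega$ and $\mathcal{H}_{(0,\infty)}$ the set of strictly positive functions. A generator is a linear operator $L:\mathcal{H}\to\mathcal{H}$ such that: $L1=0$; $\mathbb{E}[fLg]=\mathbb{E}[gLf]$ for all $f,g\in\mathcal{H}$; $\mathbb{E}[fLf]\ge 0$ for all $f\in\mathcal{H}$; and whenever $f\in\mathcal{H}$ and $\omega\in\Omega$ satisfy $f\le f(\omega)$ on $\Omega$, then $(Lf)(\omega)\ge 0$. The Dirichlet form is $\mathcal{E}(f,g)=\mathbb{E}[fLg]$. For $p\in\mathbb{R}\setminus\{0,1\}$, $p'=p/(p-1)$ denotes the Hölder conjugate, so $\frac1p+\frac1{p'}=1$ (it may be negative). *)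

(* Defs.v *)
From HB Require Import structures.
From mathcomp Require Import all_boot all_order all_algebra.
From mathcomp Require Import reals exp.
Set Implicit Arguments.
Unset Strict Implicit.
Unset Printing Implicit Defensive.
Import Order.TTheory GRing.Theory Num.Theory.
Local Open Scope ring_scope.

(* The codomain [R^o], convertible to [R], is what makes this function space
   an [lmodType R]. *)
Notation hfun R Omega := {ffun Omega -> R^o}.

Section FiniteProbabilitySpace.
Variables (R : realType) (Omega : finType).

Local Notation H := (hfun R Omega).

(* A probability on a finite space is given by its point masses mu{omega}. *)
Definition positive_probability (mu : Omega -> R) : Prop :=
  (forall w, 0 < mu w) /\ \sum_w mu w = 1.

Definition expectation (mu : Omega -> R) (f : Omega -> R) : R :=
  \sum_w f w * mu w.

Definition positive_fun (f : H) : Prop := forall w, 0 < f w.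

Record generator (mu : Omega -> R) (L : {linear H -> H}) : Prop := Generator {
  generator_const : L [ffun=> 1] = 0;
  generator_sym : forall f g : H,
    expectation mu (fun w => f w * L g w) =
    expectation mu (fun w => g w * L f w);
  generator_ge0 : forall f : H, 0 <= expectation mu (fun w => f w * L f w);
  generator_max : forall (f : H) (w : Omega),
    (forall v, f v <= f w) -> 0 <= L f w
}.

Definition dirichlet (mu : Omega -> R) (L : {linear H -> H}) (f g : H) : R :=
  expectation mu (fun w => f w * L g w).

(* [`^] is [powR], so that f^r = exp (r ln f) wherever f is positive. *)
Definition powf (f : H) (r : R) : H := [ffun w => f w `^ r].

(* The Holder conjugate; the value 0 at the excluded point p = 1 is junk. *)
Definition holder_conj (p : R) : R := p / (p - 1).

End FiniteProbabilitySpace.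

(* Main.v *)
Require Import Defs.
From HB Require Import structures.
From mathcomp Require Import all_boot all_order all_algebra.
From mathcomp Require Import classical_sets boolp topology normedtype sequences.
From mathcomp Require Import ring lra.
From mathcomp Require Import reals exp.
Set Implicit Arguments.
Unset Strict Implicit.
Unset Printing Implicit Defensive.
Import Order.TTheory GRing.Theory Num.Theory.
Import numFieldNormedType.Exports.
Local Open Scope classical_set_scope.
Local Open Scope ring_scope.

(** Since the generator is symmetric and kills constants, the Dirichlet form is
    a sum over pairs of points,
      E(f, h) = 1/2 * sum_(x, y) c_xy (f x - f y) (h x - h y),
    and the maximum principle says precisely that c_xy >= 0 for x <> y
    ([dirichlet_edges], [rate_ge0]).  It therefore suffices to show, for fixed
    a, b > 0, that
      p p' (a^(1/p) - b^(1/p)) (a^(1/p') - b^(1/p'))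
    is nonincreasing in p on (0, 2] minus 1 ([powR_conj_mono]).

    Put t = (ln a - ln b) / 2 and r = 2/p - 1, which is nonnegative and
    decreasing in p.  As 1/p' = 1 - 1/p, the product of differences equals
    2 sqrt(ab) (cosh t - cosh (r t)), and p p' = 4 / (1 - r^2), so the quantity
    is a positive constant times
      (cosh (r t) - cosh t) / (r^2 - 1).
    This is the slope, between 1 and r^2, of the function
    x |-> cosh (t sqrt x) = sum_n t^(2n) x^n / (2n)!, a power series with
    nonnegative coefficients; its slopes from 1 increase because those of each
    x^n do, being the geometric sums 1 + x + ... + x^(n-1).  Comparing slopes
    from the base point 1 handles p and q on the same or on opposite sides of 1
    uniformly. *)

(** * Slopes of the hyperbolic cosine in the squared variable *)

(** Twice the hyperbolic cosine. *)
Definition cosh2 (R : realType) (z : R) : R := expR z + expR (- z).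

Lemma cosh2_series (R : realType) (z : R) :
  series (fun n => exp_coeff z n + exp_coeff (- z) n) @ \oo --> cosh2 z.
Proof.
have -> : series (fun n => exp_coeff z n + exp_coeff (- z) n) =
    (fun n => series (exp_coeff z) n + series (exp_coeff (- z)) n).
  by apply/funext => n; rewrite /series /= big_split.
by apply: cvgD; exact: is_cvg_series_exp_coeff.
Qed.

(** The slope of x |-> 2 cosh (t sqrt x) between x = 1 and x = r^2. *)
Definition cosh2_slope (R : realType) (t r : R) : R :=
  (cosh2 (r * t) - cosh2 t) / (r ^+ 2 - 1).

(** Each slope is the geometric sum of the first m powers, whose terms are all
    nondecreasing on the nonnegative half-line. *)
Lemma ler_geometric_slope (R : realType) (m : nat) (x y : R) :
  0 <= x -> x <= y -> x != 1 -> y != 1 ->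
  (x ^+ m - 1) / (x - 1) <= (y ^+ m - 1) / (y - 1).
Proof.
move=> x0 xy x1 y1; rewrite !subrX1 !(mulrC (_ - 1)) !mulfK ?subr_eq0//.
by apply: ler_sum => i _; rewrite lerXn2r// nnegrE// (le_trans x0).
Qed.

(** The termwise comparison: odd terms of the exponential series cancel, and an
    even term is a nonnegative multiple of a slope of a monomial in r^2. *)
Lemma cosh2_coeff_slope (R : realType) (t r s : R) (n : nat) :
  0 <= r -> r <= s -> r != 1 -> s != 1 ->
  (exp_coeff (r * t) n + exp_coeff (- (r * t)) n
     - (exp_coeff t n + exp_coeff (- t) n)) / (r ^+ 2 - 1) <=
  (exp_coeff (s * t) n + exp_coeff (- (s * t)) n
     - (exp_coeff t n + exp_coeff (- t) n)) / (s ^+ 2 - 1).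
Proof.
move=> r0 rs r1 s1.
have s0 : 0 <= s := le_trans r0 rs.
have split u : exp_coeff (u * t) n + exp_coeff (- (u * t)) n
     - (exp_coeff t n + exp_coeff (- t) n) =
    (t ^+ n + (- t) ^+ n) / n`!%:R * (u ^+ n - 1).
  by rewrite /exp_coeff /= -mulrN !exprMn; ring.
rewrite !split; case: (boolP (odd n)) => [no|ne].
  by rewrite (exprNn t) -signr_odd no expr1 mulN1r subrr !mul0r.
rewrite -!(mulrA (_ / _)); apply: ler_wpM2l.
  rewrite (exprNn t) -signr_odd (negbTE ne) expr0 mul1r.
  by rewrite divr_ge0 ?addr_ge0 ?exprn_even_ge0 ?ler0n.
(* n is even here: pass to powers of r^2 and s^2. *)
rewrite -(odd_double_half n) (negbTE ne) add0n -mul2n !exprM.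
apply: ler_geometric_slope; rewrite ?sqr_ge0 ?lerXn2r ?nnegrE//.
  by rewrite sqrp_eq1.
by rewrite sqrp_eq1.
Qed.

Lemma cosh2_slope_mono (R : realType) (t r s : R) :
  0 <= r -> r <= s -> r != 1 -> s != 1 ->
  cosh2_slope t r <= cosh2_slope t s.
Proof.
move=> r0 rs r1 s1.
have cvg_slope u :
    (fun N => (series (fun n => exp_coeff (u * t) n + exp_coeff (- (u * t)) n) N
      - series (fun n => exp_coeff t n + exp_coeff (- t) n) N)
      / (u ^+ 2 - 1)) @ \oo --> cosh2_slope t u.
  by apply: cvgM; [apply: cvgB; exact: cosh2_series | exact: cvg_cst].
apply: ler_cvg_to (cvg_slope r) (cvg_slope s) _.
apply: nearW => N.
rewrite /series /= -!sumrB !mulr_suml.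
by apply: ler_sum => n _; exact: cosh2_coeff_slope.
Qed.

(** * The inequality for two points *)

(** Expanding the product, exponents with the same base add up to A or B and
    the mixed ones to (A + B) / 2 +- (2 s - 1) (A - B) / 2. *)
Lemma expR_conj_cosh2 (R : realType) (A B s : R) :
  (expR (s * A) - expR (s * B)) * (expR ((1 - s) * A) - expR ((1 - s) * B)) =
  expR ((A + B) / 2) *
    (cosh2 ((A - B) / 2) - cosh2 ((2 * s - 1) * ((A - B) / 2))).
Proof.
rewrite /cosh2 mulrBl !mulrBr !mulrDr -!expRD.
have -> : s * A + (1 - s) * A = (A + B) / 2 + (A - B) / 2 by field.
have -> : s * B + (1 - s) * B = (A + B) / 2 - (A - B) / 2 by field.
have -> : s * A + (1 - s) * B = (A + B) / 2 + (2 * s - 1) * ((A - B) / 2).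
  by field.
have -> : s * B + (1 - s) * A = (A + B) / 2 - (2 * s - 1) * ((A - B) / 2).
  by field.
ring.
Qed.

Lemma powR_conj_slope (R : realType) (a b p : R) :
  0 < a -> 0 < b -> p != 0 -> p != 1 ->
  p * holder_conj p * ((a `^ (1 / p) - b `^ (1 / p)) *
    (a `^ (1 / holder_conj p) - b `^ (1 / holder_conj p))) =
  4 * expR ((ln a + ln b) / 2) *
    cosh2_slope ((ln a - ln b) / 2) (2 / p - 1).
Proof.
move=> a0 b0 p0 p1.
have p10 : p - 1 != 0 by rewrite subr_eq0.
have -> : 1 / holder_conj p = 1 - 1 / p.
  by rewrite /holder_conj; field; rewrite p0.
have -> : p * holder_conj p = - 4 / ((2 / p - 1) ^+ 2 - 1).
  have -> : (2 / p - 1) ^+ 2 - 1 = - 4 * (p - 1) / p ^+ 2 by field.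
  by rewrite /holder_conj; field; rewrite p0 p10.
rewrite /powR !gt_eqF// expR_conj_cosh2 /cosh2_slope.
rewrite (_ : 2 * (1 / p) - 1 = 2 / p - 1); last by field.
ring.
Qed.

(** The hypothesis p <= 2 ensures 0 <= 2/p - 1, the range on which the slopes
    are monotone. *)
Lemma powR_conj_mono (R : realType) (a b p q : R) :
  0 < a -> 0 < b -> p <= 2 -> p != 1 -> 0 < q -> q != 1 -> q <= p ->
  p * holder_conj p * ((a `^ (1 / p) - b `^ (1 / p)) *
    (a `^ (1 / holder_conj p) - b `^ (1 / holder_conj p))) <=
  q * holder_conj q * ((a `^ (1 / q) - b `^ (1 / q)) *
    (a `^ (1 / holder_conj q) - b `^ (1 / holder_conj q))).
Proof.
move=> a0 b0 p2 p1 q0 q1 qp.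
have p0 : 0 < p := lt_le_trans q0 qp.
have r_neq1 (u : R) : 0 < u -> u != 1 -> 2 / u - 1 != 1.
  move=> u0; apply: contra_neq => e.
  have u2 : 2 / u = 2 by lra.
  have : 2 / u * u = 2 by rewrite divfK ?gt_eqF.
  by rewrite u2 => ?; lra.
rewrite !powR_conj_slope ?(gt_eqF p0) ?(gt_eqF q0)//.
apply: ler_wpM2l; first by rewrite mulr_ge0// expR_ge0.
apply: cosh2_slope_mono; rewrite ?r_neq1//.
  by rewrite subr_ge0 ler_pdivlMr// mul1r.
by rewrite lerD2r ler_pM2l// lef_pV2.
Qed.

(** * The Dirichlet form as a sum over pairs of points *)

Section EdgeForm.
Variables (R : realType) (Omega : finType) (mu : Omega -> R).
Variables (L : {linear hfun R Omega -> hfun R Omega}).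

Definition indic (y : Omega) : hfun R Omega := [ffun x => (x == y)%:R].

(** Minus the matrix of the bilinear form; the sign makes the off-diagonal
    entries nonnegative. *)
Definition rate (x y : Omega) : R := - (mu x * L (indic y) x).

Lemma generator_expand (f : hfun R Omega) (x : Omega) :
  L f x = \sum_y f y * L (indic y) x.
Proof.
have {1}-> : f = \sum_y f y *: indic y.
  apply/ffunP => z; rewrite sum_ffunE (bigD1 z)//= !ffunE eqxx big1 ?addr0.
    by rewrite [RHS]mulr1.
  by move=> y yz; rewrite !ffunE eq_sym (negbTE yz) scaler0.
rewrite linear_sum sum_ffunE.
by apply: eq_bigr => y _; rewrite linearZ ffunE.
Qed.

Lemma dirichlet_rate (f h : hfun R Omega) :
  dirichlet mu L f h = - \sum_x \sum_y rate x y * (f x * h y).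
Proof.
rewrite -sumrN; apply: eq_bigr => x _.
rewrite generator_expand mulr_sumr mulr_suml -sumrN.
by apply: eq_bigr => y _; rewrite /rate; ring.
Qed.

Hypothesis L_gen : generator mu L.

Lemma rate_sym (x y : Omega) : rate x y = rate y x.
Proof.
have inner z f : expectation mu (fun w => indic z w * L f w) = L f z * mu z.
  rewrite /expectation (bigD1 z)//= ffunE eqxx mul1r big1 ?addr0// => w wz.
  by rewrite ffunE (negbTE wz) !mul0r.
have := generator_sym L_gen (indic x) (indic y).
by rewrite !inner /rate => e; rewrite mulrC e mulrC.
Qed.

(** The function - indic y attains its maximum 0 at every x <> y, so the maximum
    principle applies to it there. *)
Lemma rate_ge0 (x y : Omega) : 0 < mu x -> x != y -> 0 <= rate x y.
Proof.
move=> mu0 xy; rewrite /rate -mulrN; apply: mulr_ge0; first exact: ltW.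
have : 0 <= L (- indic y) x.
  apply: (generator_max L_gen) => v.
  by rewrite !ffunE (negbTE xy) oppr0 oppr_le0 ler0n.
by rewrite linearN ffunE.
Qed.

Lemma sum_rate (x : Omega) : \sum_y rate x y = 0.
Proof.
rewrite sumrN -mulr_sumr; have := generator_expand [ffun=> 1] x.
rewrite (generator_const L_gen) ffunE => e.
rewrite (eq_bigr (fun y => [ffun=> 1 : R^o] y * L (indic y) x)).
  by rewrite -e mulr0 oppr0.
by move=> y _; rewrite ffunE mul1r.
Qed.

(** In the expanded product the diagonal terms f x * h x and f y * h y vanish
    because rows and, by symmetry, columns of [rate] sum to 0; the two cross
    terms each contribute the Dirichlet form. *)
Lemma dirichlet_edges (f h : hfun R Omega) :
  dirichlet mu L f h =
  2^-1 * \sum_x \sum_y rate x y * ((f x - f y) * (h x - h y)).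
Proof.
have diag (k : Omega -> R) : \sum_x \sum_y rate x y * k x = 0.
  by apply: big1 => x _; rewrite -mulr_suml sum_rate mul0r.
have diag' (k : Omega -> R) : \sum_x \sum_y rate x y * k y = 0.
  rewrite exchange_big /= -[RHS](diag k).
  by apply: eq_bigr => x _; apply: eq_bigr => y _; rewrite rate_sym.
have cross : \sum_x \sum_y rate x y * (f y * h x) =
    \sum_x \sum_y rate x y * (f x * h y).
  rewrite exchange_big /=.
  by apply: eq_bigr => x _; apply: eq_bigr => y _; rewrite rate_sym.
have -> : \sum_x \sum_y rate x y * ((f x - f y) * (h x - h y)) =
    \sum_x \sum_y rate x y * (f x * h x) + \sum_x \sum_y rate x y * (f y * h y)
    - (\sum_x \sum_y rate x y * (f x * h y)
       + \sum_x \sum_y rate x y * (f y * h x)).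
  rewrite -!big_split -sumrB /=; apply: eq_bigr => x _.
  by rewrite -!big_split -sumrB /=; apply: eq_bigr => y _; ring.
rewrite (diag (fun x => f x * h x)) (diag' (fun y => f y * h y)) cross.
by rewrite dirichlet_rate; field.
Qed.

End EdgeForm.

Theorem theorem2p1 (R : realType) (Omega : finType) (mu : Omega -> R)
    (mu_prob : positive_probability mu)
    (L : {linear hfun R Omega -> hfun R Omega}) (L_gen : generator mu L)
    (p q : R) (p_gt0 : 0 < p) (p_le2 : p <= 2) (p_neq1 : p != 1)
    (q_gt0 : 0 < q) (q_le2 : q <= 2) (q_neq1 : q != 1) (q_lt_p : q < p)
    (g : hfun R Omega) (g_gt0 : positive_fun g) :
  q * holder_conj q *
    dirichlet mu L (powf g (1 / q)) (powf g (1 / holder_conj q)) >=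
  p * holder_conj p *
    dirichlet mu L (powf g (1 / p)) (powf g (1 / holder_conj p)).
Proof.
have [mu_gt0 _] := mu_prob.
rewrite !(dirichlet_edges L_gen) !(mulrCA _ 2^-1); apply: ler_wpM2l; first by rewrite invr_ge0.
rewrite !mulr_sumr; apply: ler_sum => x _; rewrite !mulr_sumr.
apply: ler_sum => y _; rewrite !ffunE !(mulrCA _ (rate mu L x y)).
have [->|xy] := eqVneq x y; first by rewrite !subrr !mul0r !mulr0.
apply: ler_wpM2l; first exact: (rate_ge0 L_gen).
by apply: powR_conj_mono => //; exact: ltW.
Qed.
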